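(* Let $\mathcal{A}=\mathcal{U}_q(\widehat{\mathfrak{sl}}(2))$ and let $\Theta$ be the involution of the root lattice $\mathbb{Z}\alpha_0\oplus\mathbb{Z}\alpha_1$ with $\Theta(\alpha_0)=-\alpha_0-2\alpha_1$, $\Theta(\alpha_1)=\alpha_1$. Let $d_-\in\mathbb{C}^\times$ be arbitrary and let $\mathcal{B}\subset\mathcal{A}$ be the associated subalgebra, generated by the Cartan generator $k_1^{\pm1}$, the Chevalley generators $\xi_1^\pm$ and the twisted affine generator $$B_0^-=\xi_0^-k_0-d_-\big((\mathrm{ad}_r\,\xi_1^+\xi_1^+)\,\xi_0'^{+}\big)k_0,\qquad \xi_0'^{+}=k_0^{-1}\xi_0^+.$$ Then $\mathcal{B}$ is a left coideal subalgebra of $\mathcal{A}$: $\Delta(b)\in\mathcal{A}\otimes\mathcal{B}$ for all $b\in\mathcal{B}$.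
   Context: $q\in\mathbb{C}^\times$ is transcendental. $\mathcal{U}_q(\widehat{\mathfrak{sl}}(2))$ is generated by $\xi_i^\pm,k_i^{\pm1}$ ($i=0,1$) with relations $k_ik_j=k_jk_i$, $k_i\xi_j^\pm=q^{\pm\hat a_{ij}}\xi_j^\pm k_i$, $[\xi_i^+,\xi_j^-]=\delta_{ij}\frac{k_i-k_i^{-1}}{q-q^{-1}}$ and the quantum Serre relations, where $\hat a_{00}=\hat a_{11}=2$, $\hat a_{01}=\hat a_{10}=-2$. Coproduct: $\Delta(k_i)=k_i\otimes k_i$, $\Delta(\xi_i^+)=\xi_i^+\otimes1+k_i\otimes\xi_i^+$, $\Delta(\xi_i^-)=\xi_i^-\otimes k_i^{-1}+1\otimes\xi_i^-$. Right adjoint action: $(\mathrm{ad}_r\,\xi_i^+)a=k_i^{-1}a\,\xi_i^+-k_i^{-1}\xi_i^+a$, and $(\mathrm{ad}_r\,xy)a=(\mathrm{ad}_r\,x)((\mathrm{ad}_r\,y)a)$. *)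

(* Defs.v *)
From HB Require Import structures.
From mathcomp Require Import all_boot all_order all_algebra.
From mathcomp Require Import boolp classical_sets reals.
From mathcomp Require Import complex.

Set Implicit Arguments.
Unset Strict Implicit.
Unset Printing Implicit Defensive.

Import Order.TTheory GRing.Theory Num.Theory.
Local Open Scope ring_scope.
Local Open Scope quotient_scope.

Local Notation bilin f := (bilinear_for *:%R *:%R f).

Lemma linear_add (F : fieldType) (V U : lmodType F) (f : V -> U) : linear f ->
  {morph f : v w / v + w}.
Proof. by move=> h v w; have := h 1 v w; rewrite !scale1r. Qed.

Lemma linear_scale (F : fieldType) (V U : lmodType F) (f : V -> U) :
  linear f -> forall c, {morph f : v / c *: v}.
Proof.
move=> h c v; have f0 : f 0 = 0.
  by apply: (addrI (f 0)); rewrite -linear_add // !addr0.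
by rewrite -[c *: v]addr0 h f0 addr0.
Qed.

(* Tensor product of vector spaces.  A formal sum of pairs (v, w) represents  *)
(* the corresponding sum of pure tensors; two formal sums are identified when *)
(* no bilinear map, into any vector space, separates them.                    *)
Section Tensor.
Variables (F : fieldType) (V W : lmodType F).

Definition bilin_ext (U : lmodType F) (f : V -> W -> U) (s : seq (V * W)) : U :=
  \sum_(p <- s) f p.1 p.2.

Definition tensor_eq (s t : seq (V * W)) : Prop :=
  forall (U : lmodType F) (f : V -> W -> U), bilin f ->
    bilin_ext f s = bilin_ext f t.

Definition tensor_eqb : rel (seq (V * W)) := fun s t => `[< tensor_eq s t >].

Fact tensor_eqb_refl : reflexive tensor_eqb.
Proof. by move=> s; apply/asboolP. Qed.

Fact tensor_eqb_sym : symmetric tensor_eqb.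
Proof.
move=> s t; apply/asboolP/asboolP => h U f hf; by rewrite h.
Qed.

Fact tensor_eqb_trans : transitive tensor_eqb.
Proof.
move=> t s u /asboolP h1 /asboolP h2; apply/asboolP => U f hf.
by rewrite h1 // h2.
Qed.

Canonical tensor_equiv :=
  EquivRel tensor_eqb tensor_eqb_refl tensor_eqb_sym tensor_eqb_trans.

Definition tensor : Type := {eq_quot tensor_equiv}.
HB.instance Definition _ := Choice.on tensor.
HB.instance Definition _ := EqQuotient.on tensor.

Lemma tensorP (s t : seq (V * W)) :
  \pi_tensor s = \pi_tensor t <-> tensor_eq s t.
Proof. by split=> [/eqquotP/asboolP|h]; last by apply/eqquotP/asboolP. Qed.

Lemma tensor_reprE s : tensor_eq (repr (\pi_tensor s)) s.
Proof. by apply/tensorP; rewrite reprK. Qed.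

Definition tens (v : V) (w : W) : tensor := \pi_tensor [:: (v, w)].

Definition tensor_zero : tensor := \pi_tensor [::].
Definition tensor_add (x y : tensor) : tensor :=
  \pi_tensor (repr x ++ repr y).
Definition tensor_scale (c : F) (x : tensor) : tensor :=
  \pi_tensor [seq (c *: p.1, p.2) | p <- repr x].
Definition tensor_opp : tensor -> tensor := tensor_scale (-1).

Definition tensor_lift (U : lmodType F) (f : V -> W -> U) (x : tensor) : U :=
  bilin_ext f (repr x).

Lemma bilin_extZ (U : lmodType F) (f : V -> W -> U) c s : bilin f ->
  bilin_ext f [seq (c *: p.1, p.2) | p <- s] = c *: bilin_ext f s.
Proof.
move=> [hl _]; rewrite /bilin_ext big_map scaler_sumr; apply: eq_bigr => p _ /=.
exact: (linear_scale (hl p.2)).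
Qed.

Lemma tensor_lift_pi (U : lmodType F) (f : V -> W -> U) s : bilin f ->
  tensor_lift f (\pi_tensor s) = bilin_ext f s.
Proof. by move=> hf; apply: tensor_reprE. Qed.

Lemma tensor_sep (x y : tensor) :
  (forall (U : lmodType F) (f : V -> W -> U), bilin f ->
     tensor_lift f x = tensor_lift f y) -> x = y.
Proof.
move=> h; rewrite -[x]reprK -[y]reprK; apply/tensorP => U f hf.
exact: h.
Qed.

Lemma tensor_lift_add (U : lmodType F) (f : V -> W -> U) x y : bilin f ->
  tensor_lift f (tensor_add x y) = tensor_lift f x + tensor_lift f y.
Proof. by move=> hf; rewrite tensor_lift_pi // /bilin_ext big_cat. Qed.

Lemma tensor_lift_zero (U : lmodType F) (f : V -> W -> U) : bilin f ->
  tensor_lift f tensor_zero = 0.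
Proof. by move=> hf; rewrite tensor_lift_pi // /bilin_ext big_nil. Qed.

Lemma tensor_lift_scale (U : lmodType F) (f : V -> W -> U) c x : bilin f ->
  tensor_lift f (tensor_scale c x) = c *: tensor_lift f x.
Proof. by move=> hf; rewrite tensor_lift_pi // bilin_extZ. Qed.

Local Definition liftE :=
  (tensor_lift_add, tensor_lift_zero, tensor_lift_scale).

Fact tensor_addA : associative tensor_add.
Proof. by move=> x y z; apply: tensor_sep => U f hf; rewrite !liftE // addrA. Qed.
Fact tensor_addC : commutative tensor_add.
Proof. by move=> x y; apply: tensor_sep => U f hf; rewrite !liftE // addrC. Qed.
Fact tensor_add0 : left_id tensor_zero tensor_add.
Proof. by move=> x; apply: tensor_sep => U f hf; rewrite !liftE // add0r. Qed.
Fact tensor_addN : left_inverse tensor_zero tensor_opp tensor_add.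
Proof.
by move=> x; apply: tensor_sep => U f hf; rewrite !liftE // scaleN1r addNr.
Qed.

HB.instance Definition _ := GRing.isZmodule.Build tensor
  tensor_addA tensor_addC tensor_add0 tensor_addN.

Fact tensor_scaleA a b v :
  tensor_scale a (tensor_scale b v) = tensor_scale (a * b) v.
Proof. by apply: tensor_sep => U f hf; rewrite !liftE // scalerA. Qed.
Fact tensor_scale1 : left_id 1 tensor_scale.
Proof. by move=> x; apply: tensor_sep => U f hf; rewrite !liftE // scale1r. Qed.
Fact tensor_scaleDr : right_distributive tensor_scale +%R.
Proof.
by move=> c x y; apply: tensor_sep => U f hf; rewrite !liftE // scalerDr.
Qed.
Fact tensor_scaleDl v : {morph tensor_scale^~ v : a b / a + b}.
Proof.
by move=> a b; apply: tensor_sep => U f hf; rewrite !liftE // scalerDl.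
Qed.

HB.instance Definition _ := GRing.Zmodule_isLmodule.Build F tensor
  tensor_scaleA tensor_scale1 tensor_scaleDr tensor_scaleDl.

Lemma tensor_lift_tens (U : lmodType F) (f : V -> W -> U) v w : bilin f ->
  tensor_lift f (tens v w) = f v w.
Proof. by move=> hf; rewrite tensor_lift_pi // /bilin_ext big_seq1. Qed.

Lemma tensor_lift_linear (U : lmodType F) (f : V -> W -> U) : bilin f ->
  linear (tensor_lift f).
Proof.
by move=> hf c x y; rewrite tensor_lift_add // tensor_lift_scale.
Qed.

Lemma tens_bilinear : bilin tens.
Proof.
split=> [w|v] c a b; apply: tensor_sep => U f hf;
  rewrite tensor_lift_linear // !tensor_lift_tens //; case: hf => h1 h2.
  exact: (h1 w).
exact: (h2 v).
Qed.

Lemma tensor_sum (x : tensor) :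
  exists s : seq (V * W), x = \sum_(p <- s) tens p.1 p.2.
Proof.
exists (repr x); apply: tensor_sep => U f hf.
rewrite -[x in LHS]reprK tensor_lift_pi // /bilin_ext.
elim: (repr x) => [|p s IH]; first by rewrite !big_nil tensor_lift_zero.
by rewrite !big_cons tensor_lift_add // tensor_lift_tens // IH.
Qed.

Lemma tensor_ind (P : tensor -> Prop) :
  P 0 -> (forall v w x, P x -> P (tens v w + x)) -> forall x, P x.
Proof.
move=> h0 hD x; have [s ->] := tensor_sum x.
by elim: s => [|p s IH]; rewrite ?big_nil ?big_cons //; apply: hD.
Qed.

(* The image of X (x) Y in V (x) W; for subspaces over a field the canonical  *)
(* map is injective, so this is the subspace usually denoted X (x) Y.         *)
Definition tensor_sub (X : set V) (Y : set W) : set tensor :=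
  [set t | exists s : seq (V * W),
    (forall p, p \in s -> X p.1 /\ Y p.2) /\ t = \sum_(p <- s) tens p.1 p.2].

End Tensor.

(* (a (x) b)(a' (x) b') = aa' (x) bb'. *)
Section TensorAlgebra.
Variables (F : fieldType) (A B : algType F).
Notation T := (tensor A B).

Definition tensor_mul (x y : T) : T :=
  tensor_lift (fun a b => tensor_lift (fun a' b' => tens (a * a') (b * b')) y) x.

Fact tens_mul_bilin (a : A) (b : B) :
  bilin (fun a' b' => tens (a * a') (b * b')).
Proof.
have [hl hr] := tens_bilinear A B; split=> [w|v] c x y /=.
  by rewrite mulrDr -scalerAr; apply: (hl (b * w)).
by rewrite mulrDr -scalerAr; apply: (hr (a * v)).
Qed.

Fact tens_mul_bilin_l (y : T) :
  bilin (fun a b => tensor_lift (fun a' b' => tens (a * a') (b * b')) y).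
Proof.
have [hl hr] := tens_bilinear A B; split=> [w|v] c a b /=;
  elim/tensor_ind: y => [|v' w' y IH];
  rewrite ?(tensor_lift_zero (tens_mul_bilin _ _));
  rewrite ?(tensor_lift_add _ _ (tens_mul_bilin _ _));
  rewrite ?(tensor_lift_tens _ _ (tens_mul_bilin _ _)).
- by rewrite scaler0 addr0.
- rewrite IH scalerDr addrACA; congr (_ + _).
  by rewrite mulrDl -scalerAl; apply: (hl (w * w')).
- by rewrite scaler0 addr0.
- rewrite IH scalerDr addrACA; congr (_ + _).
  by rewrite mulrDl -scalerAl; apply: (hr (v * v')).
Qed.

Lemma tens_mulE a b a' b' :
  tensor_mul (tens a b) (tens a' b') = tens (a * a') (b * b').
Proof.
rewrite /tensor_mul tensor_lift_tens; last exact: tens_mul_bilin_l.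
by rewrite tensor_lift_tens //; apply: tens_mul_bilin.
Qed.

Fact tensor_mulDl : left_distributive tensor_mul +%R.
Proof. by move=> x y z; apply: tensor_lift_add; apply: tens_mul_bilin_l. Qed.

Fact tensor_mul0l x : tensor_mul 0 x = 0.
Proof. by apply: tensor_lift_zero; apply: tens_mul_bilin_l. Qed.

Fact tensor_mulZl c x y : c *: tensor_mul x y = tensor_mul (c *: x) y.
Proof.
by rewrite [RHS]tensor_lift_scale //; apply: tens_mul_bilin_l.
Qed.

Fact tensor_mul_linr x : linear (tensor_mul x).
Proof.
move=> c y z; elim/tensor_ind: x => [|v w x IH].
  by rewrite !tensor_mul0l scaler0 addr0.
rewrite !tensor_mulDl IH scalerDr addrACA; congr (_ + _).
rewrite /tensor_mul !tensor_lift_tens; try exact: tens_mul_bilin_l.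
exact: (tensor_lift_linear (tens_mul_bilin v w)).
Qed.

Fact tensor_mulDr : right_distributive tensor_mul +%R.
Proof. by move=> x; apply: linear_add; apply: tensor_mul_linr. Qed.

Fact tensor_mulZr c x y : c *: tensor_mul x y = tensor_mul x (c *: y).
Proof. by rewrite (linear_scale (@tensor_mul_linr x)). Qed.

Fact tensor_mul0r x : tensor_mul x 0 = 0.
Proof. by rewrite -[X in tensor_mul x X](scale0r 0) -tensor_mulZr scale0r. Qed.

Fact tensor_mulA : associative tensor_mul.
Proof.
move=> x y z; elim/tensor_ind: x => [|a b x IHx].
  by rewrite !tensor_mul0l.
rewrite !tensor_mulDl -IHx; congr (_ + _) => {x IHx}.
elim/tensor_ind: y => [|a' b' y IHy].
  by rewrite tensor_mul0l tensor_mul0r tensor_mul0l.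
rewrite tensor_mulDl !tensor_mulDr tensor_mulDl -IHy; congr (_ + _) => {y IHy}.
elim/tensor_ind: z => [|a'' b'' z IHz]; first by rewrite !tensor_mul0r.
by rewrite !tensor_mulDr IHz !tens_mulE !mulrA.
Qed.

Fact tensor_mul1l : left_id (tens 1 1) tensor_mul.
Proof.
elim/tensor_ind => [|a b x IH]; first by rewrite tensor_mul0r.
by rewrite tensor_mulDr IH tens_mulE !mul1r.
Qed.

Fact tensor_mul1r : right_id (tens 1 1) tensor_mul.
Proof.
elim/tensor_ind => [|a b x IH]; first by rewrite tensor_mul0l.
by rewrite tensor_mulDl IH tens_mulE !mulr1.
Qed.

HB.instance Definition _ := GRing.Zmodule_isPzRing.Build T
  tensor_mulA tensor_mul1l tensor_mul1r tensor_mulDl tensor_mulDr.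

Lemma tensM (a a' : A) (b b' : B) :
  tens a b * tens a' b' = tens (a * a') (b * b').
Proof. exact: tens_mulE. Qed.

Lemma tens1 : tens 1 1 = 1 :> T. Proof. by []. Qed.

End TensorAlgebra.

Inductive uq_gen : Type :=
  | GK of 'I_2 | GKV of 'I_2 | GXp of 'I_2 | GXm of 'I_2.

Definition ahat (i j : 'I_2) : int := if i == j then 2 else -2.

(* As 1 - ahat i j = 3 for i != j, the Serre relations are cubic; the middle  *)
(* q-binomial coefficients both equal [3]_q = q^2 + 1 + q^-2.                 *)
Definition qserre (F : fieldType) (q : F) (A : algType F) (x y : A) : A :=
  let c := q ^+ 2 + 1 + q ^- 2 in
  x ^+ 3 * y - c *: (x ^+ 2 * y * x) + c *: (x * y * x ^+ 2) - y * x ^+ 3.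

Lemma lrmorph_qserre (F : fieldType) (q : F) (A B : algType F)
    (f : {lrmorphism A -> B}) (x y : A) :
  f (qserre q x y) = qserre q (f x) (f y).
Proof.
rewrite /qserre !(rmorphB, rmorphD) /= ![f (_ *: _)]linearZ /=.
by rewrite !(rmorphXn, rmorphM).
Qed.

Record uq_relations (F : fieldType) (q : F) (A : algType F)
    (g : uq_gen -> A) : Prop := UqRelations {
  rel_kV : forall i, g (GK i) * g (GKV i) = 1;
  rel_Vk : forall i, g (GKV i) * g (GK i) = 1;
  rel_kk : forall i j, g (GK i) * g (GK j) = g (GK j) * g (GK i);
  rel_kp : forall i j,
    g (GK i) * g (GXp j) = q ^ ahat i j *: (g (GXp j) * g (GK i));
  rel_km : forall i j,
    g (GK i) * g (GXm j) = q ^ (- ahat i j) *: (g (GXm j) * g (GK i));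
  rel_pm : forall i j, g (GXp i) * g (GXm j) - g (GXm j) * g (GXp i) =
    if i == j then (q - q^-1)^-1 *: (g (GK i) - g (GKV i)) else 0;
  rel_sp : forall i j, i != j -> qserre q (g (GXp i)) (g (GXp j)) = 0;
  rel_sm : forall i j, i != j -> qserre q (g (GXm i)) (g (GXm j)) = 0 }.

Inductive uq_expr (F : Type) : Type :=
  | EGen of uq_gen
  | EConst of F
  | EAdd of uq_expr F & uq_expr F
  | EMul of uq_expr F & uq_expr F.
Arguments EGen {F}.

HB.instance Definition _ (F : Type) := gen_eqMixin (uq_expr F).
HB.instance Definition _ (F : Type) := gen_choiceMixin (uq_expr F).

Fixpoint uq_eval (F : fieldType) (A : algType F) (g : uq_gen -> A)
    (e : uq_expr F) : A :=
  match e with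
  | EGen x => g x
  | EConst c => c%:A
  | EAdd e1 e2 => uq_eval g e1 + uq_eval g e2
  | EMul e1 e2 => uq_eval g e1 * uq_eval g e2
  end.

(* The algebra presented by these generators and relations: expressions       *)
(* modulo the identities which follow from the relations, i.e. which hold in  *)
(* every algebra containing elements that satisfy them.  Lemmas               *)
(* uqg_relations, Uq_liftE and Uq_lift_unique are the universal property that *)
(* defines the quotient of the free algebra by the ideal of the relations.    *)
Section Uq.
Variables (F : fieldType) (q : F).

Definition uq_eq (e1 e2 : uq_expr F) : Prop :=
  forall (A : algType F) (g : uq_gen -> A), uq_relations q g ->
    uq_eval g e1 = uq_eval g e2.

Definition uq_eqb : rel (uq_expr F) := fun e1 e2 => `[< uq_eq e1 e2 >].

Fact uq_eqb_refl : reflexive uq_eqb.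
Proof. by move=> s; apply/asboolP. Qed.

Fact uq_eqb_sym : symmetric uq_eqb.
Proof. by move=> s t; apply/asboolP/asboolP => h A g hg; rewrite h. Qed.

Fact uq_eqb_trans : transitive uq_eqb.
Proof.
move=> t s u /asboolP h1 /asboolP h2; apply/asboolP => A g hg.
by rewrite h1 // h2.
Qed.

Canonical uq_equiv := EquivRel uq_eqb uq_eqb_refl uq_eqb_sym uq_eqb_trans.

Definition Uq : Type := {eq_quot uq_equiv}.
HB.instance Definition _ := Choice.on Uq.
HB.instance Definition _ := EqQuotient.on Uq.

Lemma UqP e1 e2 : \pi_Uq e1 = \pi_Uq e2 <-> uq_eq e1 e2.
Proof. by split=> [/eqquotP/asboolP|h]; last by apply/eqquotP/asboolP. Qed.

Definition uq_lift (A : algType F) (g : uq_gen -> A) (x : Uq) : A :=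
  uq_eval g (repr x).

Lemma uq_lift_pi (A : algType F) (g : uq_gen -> A) e : uq_relations q g ->
  uq_lift g (\pi_Uq e) = uq_eval g e.
Proof. by move=> hg; apply: (_ : uq_eq _ _) => //; apply/UqP; rewrite reprK. Qed.

Lemma uq_sep (x y : Uq) :
  (forall (A : algType F) (g : uq_gen -> A), uq_relations q g ->
     uq_lift g x = uq_lift g y) -> x = y.
Proof.
move=> h; rewrite -[x]reprK -[y]reprK; apply/UqP => A g hg; exact: h.
Qed.

Definition uq_const (c : F) : Uq := \pi_Uq (EConst c).
Definition uq_add (x y : Uq) : Uq := \pi_Uq (EAdd (repr x) (repr y)).
Definition uq_mul (x y : Uq) : Uq := \pi_Uq (EMul (repr x) (repr y)).
Definition uq_scale (c : F) (x : Uq) : Uq := uq_mul (uq_const c) x.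
Definition uq_opp (x : Uq) : Uq := uq_scale (-1) x.

Section Lift.
Variables (A : algType F) (g : uq_gen -> A).
Hypothesis hg : uq_relations q g.

Lemma uq_lift_const c : uq_lift g (uq_const c) = c%:A.
Proof. exact: uq_lift_pi. Qed.
Lemma uq_lift_add x y : uq_lift g (uq_add x y) = uq_lift g x + uq_lift g y.
Proof. exact: uq_lift_pi. Qed.
Lemma uq_lift_mul x y : uq_lift g (uq_mul x y) = uq_lift g x * uq_lift g y.
Proof. exact: uq_lift_pi. Qed.
Lemma uq_lift_scale c x : uq_lift g (uq_scale c x) = c *: uq_lift g x.
Proof. by rewrite uq_lift_mul uq_lift_const -scalerAl mul1r. Qed.
Lemma uq_lift_opp x : uq_lift g (uq_opp x) = - uq_lift g x.
Proof. by rewrite uq_lift_scale scaleN1r. Qed.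
End Lift.

Local Definition uqE := (uq_lift_const, uq_lift_add, uq_lift_mul,
  uq_lift_scale, uq_lift_opp).

Fact uq_addA : associative uq_add.
Proof. by move=> x y z; apply: uq_sep => A g hg; rewrite !uqE // addrA. Qed.
Fact uq_addC : commutative uq_add.
Proof. by move=> x y; apply: uq_sep => A g hg; rewrite !uqE // addrC. Qed.
Fact uq_add0 : left_id (uq_const 0) uq_add.
Proof. by move=> x; apply: uq_sep => A g hg; rewrite !uqE // scale0r add0r. Qed.
Fact uq_addN : left_inverse (uq_const 0) uq_opp uq_add.
Proof. by move=> x; apply: uq_sep => A g hg; rewrite !uqE // scale0r addNr. Qed.

HB.instance Definition _ := GRing.isZmodule.Build Uq
  uq_addA uq_addC uq_add0 uq_addN.

Fact uq_mulA : associative uq_mul.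
Proof. by move=> x y z; apply: uq_sep => A g hg; rewrite !uqE // mulrA. Qed.
Fact uq_mul1l : left_id (uq_const 1) uq_mul.
Proof. by move=> x; apply: uq_sep => A g hg; rewrite !uqE // scale1r mul1r. Qed.
Fact uq_mul1r : right_id (uq_const 1) uq_mul.
Proof. by move=> x; apply: uq_sep => A g hg; rewrite !uqE // scale1r mulr1. Qed.
Fact uq_mulDl : left_distributive uq_mul +%R.
Proof. by move=> x y z; apply: uq_sep => A g hg; rewrite !uqE // mulrDl. Qed.
Fact uq_mulDr : right_distributive uq_mul +%R.
Proof. by move=> x y z; apply: uq_sep => A g hg; rewrite !uqE // mulrDr. Qed.

(* The counit shows that the relations do not collapse the algebra. *)
Definition uq_counit_gen (x : uq_gen) : F^o :=
  match x with GK _ | GKV _ => 1 | GXp _ | GXm _ => 0 end.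

Fact uq_counit_relations : uq_relations q uq_counit_gen.
Proof.
split=> /= *; rewrite ?mulr1 ?mulr0 ?mul0r ?scaler0 ?subrr //.
  by case: ifP; rewrite ?scaler0.
all: by rewrite /qserre !(expr0n, mulr0, mul0r, scaler0, subr0, addr0).
Qed.

Fact uq_one_neq0 : uq_const 1 != 0.
Proof.
apply/eqP => /(congr1 (uq_lift uq_counit_gen)).
rewrite !uq_lift_pi /=; try exact: uq_counit_relations.
by rewrite scale1r scale0r => /eqP; rewrite oner_eq0.
Qed.

HB.instance Definition _ := GRing.Zmodule_isNzRing.Build Uq
  uq_mulA uq_mul1l uq_mul1r uq_mulDl uq_mulDr uq_one_neq0.

Fact uq_scaleA a b v : uq_scale a (uq_scale b v) = uq_scale (a * b) v.
Proof. by apply: uq_sep => A g hg; rewrite !uqE // scalerA. Qed.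
Fact uq_scale1 : left_id 1 uq_scale.
Proof. by move=> x; apply: uq_sep => A g hg; rewrite !uqE // scale1r. Qed.
Fact uq_scaleDr : right_distributive uq_scale +%R.
Proof. by move=> c x y; apply: uq_sep => A g hg; rewrite !uqE // scalerDr. Qed.
Fact uq_scaleDl v : {morph uq_scale^~ v : a b / a + b}.
Proof. by move=> a b; apply: uq_sep => A g hg; rewrite !uqE // scalerDl. Qed.

HB.instance Definition _ := GRing.Zmodule_isLmodule.Build F Uq
  uq_scaleA uq_scale1 uq_scaleDr uq_scaleDl.

Fact uq_scaleAl (a : F) (u v : Uq) : a *: (u * v) = (a *: u) * v.
Proof. exact: uq_mulA. Qed.

HB.instance Definition _ := GRing.Lmodule_isLalgebra.Build F Uq uq_scaleAl.

Fact uq_scaleAr (a : F) (u v : Uq) : a *: (u * v) = u * (a *: v).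
Proof.
apply: uq_sep => A g hg.
change (uq_lift g (uq_scale a (uq_mul u v)) =
        uq_lift g (uq_mul u (uq_scale a v))).
by rewrite !uqE // scalerAr.
Qed.

HB.instance Definition _ := GRing.Lalgebra_isAlgebra.Build F Uq uq_scaleAr.

Definition uqg (x : uq_gen) : Uq := \pi_Uq (EGen x).

Section UniversalProperty.
Variables (A : algType F) (g : uq_gen -> A) (hg : uq_relations q g).

Definition Uq_lift of uq_relations q g : Uq -> A := uq_lift g.
Notation lift := (Uq_lift hg).

Fact Uq_lift_nmod : nmod_morphism lift.
Proof.
split=> [|x y]; last exact: (uq_lift_add hg).
by rewrite [LHS](uq_lift_const hg) scale0r.
Qed.
Fact Uq_lift_monoid : monoid_morphism lift.
Proof.
split=> [|x y]; last exact: (uq_lift_mul hg).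
by rewrite [LHS](uq_lift_const hg) scale1r.
Qed.
Fact Uq_lift_scalable : scalable lift.
Proof. by move=> c x; apply: (uq_lift_scale hg). Qed.

HB.instance Definition _ := GRing.isNmodMorphism.Build Uq A lift Uq_lift_nmod.
HB.instance Definition _ :=
  GRing.isMonoidMorphism.Build Uq A lift Uq_lift_monoid.
HB.instance Definition _ :=
  GRing.isScalable.Build F Uq A *:%R lift Uq_lift_scalable.

Lemma Uq_liftE x : lift (uqg x) = g x.
Proof. exact: (uq_lift_pi _ hg). Qed.
End UniversalProperty.

Lemma uq_pi_eval e : \pi_Uq e = uq_eval uqg e.
Proof.
elim: e => [x|c|e1 IH1 e2 IH2|e1 IH1 e2 IH2] //=.
- apply: uq_sep => A g hg.
  rewrite -[RHS]/(Uq_lift hg _) linearZ rmorph1.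
  exact (uq_lift_const hg c).
- rewrite -IH1 -IH2; apply: uq_sep => A g hg.
  rewrite -[RHS]/(Uq_lift hg _) rmorphD.
  by rewrite [LHS](uq_lift_pi _ hg) [X in X + _](uq_lift_pi _ hg) [X in _ + X](uq_lift_pi _ hg).
- rewrite -IH1 -IH2; apply: uq_sep => A g hg.
  rewrite -[RHS]/(Uq_lift hg _) rmorphM.
  by rewrite [LHS](uq_lift_pi _ hg) [X in X * _](uq_lift_pi _ hg) [X in _ * X](uq_lift_pi _ hg).
Qed.

Lemma Uq_lift_unique (A : algType F) (f1 f2 : {lrmorphism Uq -> A}) :
  (forall x, f1 (uqg x) = f2 (uqg x)) -> f1 =1 f2.
Proof.
move=> h x; rewrite -[x]reprK uq_pi_eval.
elim: (repr x) => [y|c|e1 IH1 e2 IH2|e1 IH1 e2 IH2] /=.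
- exact: h.
- by rewrite !linearZ !rmorph1.
- by rewrite !rmorphD; congr (_ + _).
- by rewrite !rmorphM; congr (_ * _).
Qed.

Lemma uqg_relations : uq_relations q uqg.
Proof.
split=> i => [||j|j|j|j|j ij|j ij]; apply: uq_sep => A g hg;
  rewrite -![uq_lift g _]/(Uq_lift hg _).
- by rewrite rmorphM rmorph1 /= !Uq_liftE (rel_kV hg).
- by rewrite rmorphM rmorph1 /= !Uq_liftE (rel_Vk hg).
- by rewrite !rmorphM /= !Uq_liftE (rel_kk hg).
- by rewrite linearZ !rmorphM /= !Uq_liftE (rel_kp hg).
- by rewrite linearZ !rmorphM /= !Uq_liftE (rel_km hg).
- rewrite rmorphB !rmorphM /= !Uq_liftE (rel_pm hg).
  by case: ifP; rewrite ?rmorph0 // linearZ rmorphB /= !Uq_liftE.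
- by rewrite lrmorph_qserre rmorph0 /= !Uq_liftE (rel_sp hg ij).
- by rewrite lrmorph_qserre rmorph0 /= !Uq_liftE (rel_sm hg ij).
Qed.

End Uq.

Definition uk (F : fieldType) (q : F) (i : 'I_2) : Uq q := uqg q (GK i).
Definition ukV (F : fieldType) (q : F) (i : 'I_2) : Uq q := uqg q (GKV i).
Definition xip (F : fieldType) (q : F) (i : 'I_2) : Uq q := uqg q (GXp i).
Definition xim (F : fieldType) (q : F) (i : 'I_2) : Uq q := uqg q (GXm i).

Section UqTensor.
Variables (F : fieldType) (q : F).
Notation U := (Uq q).
Notation eps := (Uq_lift (uq_counit_relations q)).

Fact tensor_Uq_one_neq0 : (1 : tensor U U) != 0.
Proof.
pose f (x y : U) : F^o := eps x * eps y.
have hf : bilin f.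
  split=> [w|v] c x y; rewrite /f /= linearP /=.
    by rewrite mulrDl -scalerAl.
  by rewrite mulrDr -scalerAr.
apply/eqP => /(congr1 (tensor_lift f)).
rewrite [RHS](tensor_lift_zero hf) -tens1 tensor_lift_tens // /f !rmorph1 mulr1.
by move/eqP; rewrite oner_eq0.
Qed.

HB.instance Definition _ := GRing.PzSemiRing_isNonZero.Build (tensor U U)
  tensor_Uq_one_neq0.
HB.instance Definition _ := GRing.Lmodule_isLalgebra.Build F (tensor U U)
  (@tensor_mulZl F U U).
HB.instance Definition _ := GRing.Lalgebra_isAlgebra.Build F (tensor U U)
  (@tensor_mulZr F U U).
End UqTensor.

Section SerreCoproduct.
Variables (F : fieldType) (A : algType F).
Implicit Types (c r s t : F) (x y z u : A).

Local Definition qcomm c x u : A := x * u - c *: (u * x).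

Lemma qcommD c x y u : y * u = c *: (u * y) -> qcomm c (x + y) u = qcomm c x u.
Proof.
by move=> h; rewrite /qcomm mulrDl mulrDr h scalerDr opprD addrACA subrr addr0.
Qed.

Lemma qcomm_comm c r t x y u : y * x = t *: (x * y) -> y * u = r *: (u * y) ->
  y * qcomm c x u = (t * r) *: (qcomm c x u * y).
Proof.
move=> hx hu; rewrite /qcomm mulrBr mulrBl scalerBr mulrA hx -scalerAl -mulrA hu.
rewrite -!scalerAr !scalerA mulrA; congr (_ - _).
rewrite mulrA hu -!scalerAl -[u * y * x]mulrA hx -scalerAr !scalerA mulrA.
by rewrite [t * r]mulrC [r * t * c]mulrC mulrA.
Qed.

Lemma qserreE (q : F) x y : q != 0 ->
  qserre q x y = qcomm (q ^+ 2) x (qcomm 1 x (qcomm (q ^- 2) x y)).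
Proof.
move=> q0; have ts : q ^+ 2 * q ^- 2 = 1 by rewrite mulfV // expf_neq0.
rewrite /qserre /qcomm; move: (q ^+ 2) (q ^- 2) ts => t s ts.
rewrite !(mulrBl, mulrBr, scalerBr, scale1r) -!(scalerAl, scalerAr) !scalerA.
rewrite !exprS !expr0 !mulr1 !mulrA ts scale1r !scalerDl !scale1r.
move: (x * x * x * y) (x * x * y * x) (x * y * x * x) (y * x * x * x).
move=> a b d e; rewrite !opprD !opprK.
by rewrite !addrA [LHS](ACl (1*4*3*7*2*6*5*8)).
Qed.

Lemma qserre_skewl (q : F) x y z : q != 0 ->
  y * x = q ^+ 2 *: (x * y) -> y * z = q ^- 2 *: (z * y) ->
  qserre q (x + y) z = qserre q x z.
Proof.
move=> q0 hx hz; have ts : q ^+ 2 * q ^- 2 = 1 by rewrite mulfV // expf_neq0.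
rewrite !qserreE // (qcommD _ hz).
have h1 := qcomm_comm (q ^- 2) hx hz; rewrite ts in h1.
rewrite (qcommD _ h1).
by have h2 := qcomm_comm 1 hx h1; rewrite mulr1 in h2; rewrite (qcommD _ h2).
Qed.

Lemma qserreV (q : F) x y : qserre q^-1 x y = qserre q x y.
Proof.
rewrite /qserre; suff -> : q^-1 ^+ 2 + 1 + q^-1 ^- 2 = q ^+ 2 + 1 + q ^- 2 by [].
by rewrite exprVn invrK [LHS]addrC [q ^- 2 + 1]addrC addrA.
Qed.

Lemma qserreDr (q : F) x z w : qserre q x (z + w) = qserre q x z + qserre q x w.
Proof.
rewrite /qserre !(mulrDl, mulrDr, scalerDr, opprD) !addrA.
by rewrite [LHS](ACl (1*3*5*7*2*4*6*8)).
Qed.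

Lemma qserreD (q : F) x y z w : q != 0 ->
  y * x = q ^+ 2 *: (x * y) -> y * z = q ^- 2 *: (z * y) ->
  x * w = q ^+ 2 *: (w * x) ->
  qserre q x z = 0 -> qserre q y w = 0 -> qserre q (x + y) (z + w) = 0.
Proof.
move=> q0 hyx hyz hxw hx hy; rewrite qserreDr (qserre_skewl q0) // hx add0r.
have ts : q ^- 2 * q ^+ 2 = 1 by rewrite mulVf // expf_neq0.
rewrite -qserreV addrC qserre_skewl ?invr_eq0 ?qserreV // exprVn ?invrK //.
by rewrite hyx scalerA ts scale1r.
Qed.

End SerreCoproduct.

Section TensSerre.
Variables (F : fieldType) (q : F).
Notation U := (Uq q).
Implicit Types (a b x y : U).

Lemma tensZl c x y : tens (c *: x) y = c *: tens x y.
Proof. exact: (linear_scale ((tens_bilinear U U).1 y)). Qed.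
Lemma tensZr c x y : tens x (c *: y) = c *: tens x y.
Proof. exact: (linear_scale ((tens_bilinear U U).2 x)). Qed.
Lemma tensDl x x' y : tens (x + x') y = tens x y + tens x' y.
Proof. exact: (linear_add ((tens_bilinear U U).1 y)). Qed.
Lemma tensDr x y y' : tens x (y + y') = tens x y + tens x y'.
Proof. exact: (linear_add ((tens_bilinear U U).2 x)). Qed.
Lemma tensNl x y : tens (- x) y = - tens x y.
Proof. by rewrite -scaleN1r tensZl scaleN1r. Qed.
Lemma tensNr x y : tens x (- y) = - tens x y.
Proof. by rewrite -scaleN1r tensZr scaleN1r. Qed.
Lemma tens0l y : tens 0 y = 0 :> tensor U U.
Proof. by rewrite -(scale0r 0) tensZl scale0r. Qed.
Lemma tens0r x : tens x 0 = 0 :> tensor U U.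
Proof. by rewrite -(scale0r 0) tensZr scale0r. Qed.

Lemma tens_qserrel a b x y : x * y = y * x ->
  qserre q (tens a x) (tens b y) = tens (qserre q a b) (x ^+ 3 * y).
Proof.
move=> xy; rewrite /qserre; move: (q ^+ 2 + 1 + q ^- 2) => c.
rewrite !exprS !expr0 !mulr1 !tensM !tensDl !tensNl !tensZl !mulrA.
have e : x * x * y * x = x * x * x * y by rewrite -[LHS]mulrA -xy mulrA.
have e2 : x * y * x * x = x * x * x * y by rewrite -[x * y * x]mulrA -xy mulrA.
by rewrite -xy e e2.
Qed.

Lemma tens_qserrer a b x y : a * b = b * a ->
  qserre q (tens a x) (tens b y) = tens (a ^+ 3 * b) (qserre q x y).
Proof.
move=> ab; rewrite /qserre; move: (q ^+ 2 + 1 + q ^- 2) => c.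
rewrite !exprS !expr0 !mulr1 !tensM !tensDr !tensNr !tensZr !mulrA.
have e : a * a * b * a = a * a * a * b by rewrite -[LHS]mulrA -ab mulrA.
have e2 : a * b * a * a = a * a * a * b by rewrite -[a * b * a]mulrA -ab mulrA.
by rewrite -ab e e2.
Qed.
End TensSerre.

Definition Delta_gen (F : fieldType) (q : F) (x : uq_gen) :
    tensor (Uq q) (Uq q) :=
  match x with
  | GK i => tens (uk q i) (uk q i)
  | GKV i => tens (ukV q i) (ukV q i)
  | GXp i => tens (xip q i) 1 + tens (uk q i) (xip q i)
  | GXm i => tens (xim q i) (ukV q i) + tens 1 (xim q i)
  end.

Section Coproduct.
Variables (F : fieldType) (q : F).
Hypothesis q0 : q != 0.
Notation K := (uk q).
Notation V := (ukV q).
Notation P := (xip q).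
Notation M := (xim q).

Lemma ukK i : K i * V i = 1. Proof. exact: (rel_kV (uqg_relations q)). Qed.
Lemma ukVK i : V i * K i = 1. Proof. exact: (rel_Vk (uqg_relations q)). Qed.
Lemma uk_comm i j : K i * K j = K j * K i.
Proof. exact: (rel_kk (uqg_relations q)). Qed.
Lemma uk_xip i j : K i * P j = q ^ ahat i j *: (P j * K i).
Proof. exact: (rel_kp (uqg_relations q)). Qed.
Lemma uk_xim i j : K i * M j = q ^ (- ahat i j) *: (M j * K i).
Proof. exact: (rel_km (uqg_relations q)). Qed.
Lemma xip_xim i j : P i * M j - M j * P i =
  if i == j then (q - q^-1)^-1 *: (K i - V i) else 0.
Proof. exact: (rel_pm (uqg_relations q)). Qed.
Lemma xip_serre i j : i != j -> qserre q (P i) (P j) = 0.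
Proof. exact: (rel_sp (uqg_relations q)). Qed.
Lemma xim_serre i j : i != j -> qserre q (M i) (M j) = 0.
Proof. exact: (rel_sm (uqg_relations q)). Qed.

Lemma ukV_uk i j : V i * K j = K j * V i.
Proof. by rewrite -[LHS]mulr1 -(ukK i) mulrA -[_ * K i]mulrA uk_comm
  [V i * _]mulrA ukVK mul1r. Qed.

Lemma ukV_comm i j : V i * V j = V j * V i.
Proof. by rewrite -[LHS]mulr1 -(ukK i) mulrA -[_ * K i]mulrA ukV_uk
  [V i * _]mulrA ukVK mul1r. Qed.

Lemma qzK (n : int) : q ^ n * q ^ (- n) = 1.
Proof. by rewrite -expfzDr // subrr. Qed.

Lemma ukV_qcomm i (c d : F) x : c * d = 1 -> K i * x = d *: (x * K i) ->
  V i * x = c *: (x * V i).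
Proof.
move=> cd h; have h' : x * K i = c *: (K i * x) by rewrite h scalerA cd scale1r.
rewrite -[V i * x]mulr1 -(ukK i) mulrA -[V i * x * K i]mulrA h'.
by rewrite -scalerAr [V i * _]mulrA ukVK mul1r -scalerAl.
Qed.

Lemma ukV_xip i j : V i * P j = q ^ (- ahat i j) *: (P j * V i).
Proof. by apply: (ukV_qcomm _ (uk_xip i j)); rewrite mulrC qzK. Qed.
Lemma ukV_xim i j : V i * M j = q ^ ahat i j *: (M j * V i).
Proof. by apply: (ukV_qcomm _ (uk_xim i j)); rewrite qzK. Qed.

Lemma ahat_sym i j : ahat i j = ahat j i.
Proof. by rewrite /ahat eq_sym. Qed.

Fact Delta_relations : uq_relations q (Delta_gen q).
Proof.
split=> [i|i|i j|i j|i j|i j|i j ij|i j ij] /=.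
- by rewrite tensM ukK.
- by rewrite tensM ukVK.
- by rewrite !tensM (uk_comm i j).
- rewrite mulrDr mulrDl !tensM mulr1 mul1r uk_xip tensZl tensZr (uk_comm i j).
  by rewrite scalerDr.
- rewrite mulrDr mulrDl !tensM mulr1 mul1r uk_xim tensZl tensZr (ukV_uk j i).
  by rewrite scalerDr.
- rewrite !(mulrDl, mulrDr) !tensM !(mulr1, mul1r).
  have -> : tens (K i * M j) (P i * V j) = tens (M j * K i) (V j * P i).
    rewrite uk_xim ukV_xip tensZl tensZr ahat_sym; congr (_ *: _).
  rewrite !opprD !addrA.
  rewrite [LHS](ACl ((1*5)*(3*6)*(2*7)*(4*8))) /= !subrr !addr0.
  rewrite -tensNl -tensNr -tensDl -tensDr.
  rewrite -[P i * M j + _]/(P i * M j - M j * P i) !xip_xim.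
  case: eqP => [<-|_]; last by rewrite tens0l tens0r addr0.
  rewrite tensZl tensZr -scalerDr tensDl tensDr tensNl tensNr.
  by rewrite [X in _ *: X]addrC addrA subrK.
- apply: qserreD => //.
  + by rewrite !tensM !mulr1 mul1r uk_xip /ahat eqxx tensZl.
  + by rewrite !tensM !mulr1 mul1r uk_xip /ahat (negPf ij) tensZl.
  + rewrite !tensM mulr1 mul1r uk_xip /ahat eq_sym (negPf ij) tensZl.
    by rewrite scalerA [X in X *: _](qzK 2) scale1r.
  + by rewrite (tens_qserrel _ _ (erefl (1 * 1))) xip_serre // tens0l.
  + by rewrite (tens_qserrer _ _ (uk_comm i j)) xip_serre // tens0r.
- rewrite -qserreV; apply: qserreD; rewrite ?invr_eq0 // ?exprVn ?invrK.
  + rewrite !tensM mulr1 mul1r ukV_xim /ahat eqxx tensZr.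
    by rewrite scalerA [X in X *: _](qzK (-2)) scale1r.
  + rewrite !tensM mulr1 mul1r ukV_xim /ahat eq_sym (negPf ij) tensZr.
    by rewrite scalerA [X in X *: _](qzK 2) scale1r.
  + by rewrite !tensM mulr1 mul1r ukV_xim /ahat (negPf ij) tensZr.
  + by rewrite qserreV (tens_qserrel _ _ (ukV_comm i j)) xim_serre // tens0l.
  + by rewrite qserreV (tens_qserrer _ _ (erefl (1 * 1))) xim_serre // tens0r.
Qed.
End Coproduct.

Definition Delta (F : fieldType) (q : F) (q0 : q != 0) :
  {lrmorphism Uq q -> tensor (Uq q) (Uq q)} := Uq_lift (Delta_relations q0).

Definition subalg_gen (F : fieldType) (A : algType F) (S : set A) : set A :=
  smallest (fun B : set A => GRing.subalg_closed [in B]) S.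

Definition left_coideal_subalgebra (F : fieldType) (q : F) (q0 : q != 0)
    (B : set (Uq q)) : Prop :=
  GRing.subalg_closed [in B] /\
  forall b, B b -> tensor_sub [set: Uq q] B (Delta q0 b).

Definition i0 : 'I_2 := ord0.
Definition i1 : 'I_2 := ord_max.

(* The right adjoint action of xi_i^+, and of a word xi_(i_1)^+ ... xi_(i_n)^+ *)
(* through (ad_r xy) a = (ad_r x) ((ad_r y) a).                               *)
Definition ad_r1 (F : fieldType) (q : F) (i : 'I_2) (a : Uq q) : Uq q :=
  ukV q i * a * xip q i - ukV q i * xip q i * a.
Definition ad_r (F : fieldType) (q : F) (w : seq 'I_2) (a : Uq q) : Uq q :=
  foldr (@ad_r1 F q) a w.

Definition xip' (F : fieldType) (q : F) (i : 'I_2) : Uq q := ukV q i * xip q i.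

Definition B0minus (F : fieldType) (q d : F) : Uq q :=
  xim q i0 * uk q i0 - (d *: ad_r [:: i1; i1] (xip' q i0)) * uk q i0.

Definition Bsub (F : fieldType) (q d : F) : set (Uq q) :=
  subalg_gen [set uk q i1; ukV q i1; xip q i1; xim q i1; B0minus q d].

Arguments Bsub {F} q d.

Definition rootlat : zmodType := (int * int)%type.
Definition alpha (i : 'I_2) : rootlat := if i == i0 then (1, 0) else (0, 1).

(* Main.v *)
(* It suffices to check the generators, and only B_0^- is not immediate.  Put  *)
(* a = k_0^-1 xi_0^+, so that Delta a = 1 (x) a + a (x) k_0^-1.  The adjoint   *)
(* action of Delta xi_1^+ restricts to ad_r xi_1^+ on 1 (x) A, hence           *)
(* Delta ((ad_r xi_1^+)^2 a) = 1 (x) (ad_r xi_1^+)^2 a + r, where r comes from *)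
(* a (x) k_0^-1.  That action preserves the space of tensors t such that       *)
(* t (k_0 (x) k_0) lies in A (x) B, since conjugation by k_0 (x) k_0 rescales  *)
(* Delta xi_1^+; so r (k_0 (x) k_0) lies in A (x) B, and modulo A (x) B one    *)
(* gets Delta B_0^- = k_0 (x) B_0^-.                                           *)

Require Import Defs.
From mathcomp Require Import all_boot all_order all_algebra.
From mathcomp Require Import classical_sets reals.
From mathcomp Require Import complex.

Import Order.TTheory GRing.Theory Num.Theory.
Local Open Scope ring_scope.
Local Open Scope complex_scope.

(** [Delta] is an algebra morphism and A (x) B is a subalgebra ([tensor_sub_closed]), so the
    elements with coproduct in A (x) B form a subalgebra ([subalg_closed_preim]); it contains B as
    soon as it contains the generators of B. For [B0minus], [Delta_ad_r1_skew] splits the coproduct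
    of (ad_r xi_1^+)^2 a into 1 (x) (ad_r xi_1^+)^2 a plus a remainder r. The right leg of r carries
    k_0^-1, which is not a generator of B. The factor k_0 (x) k_0 coming from the last k_0 of
    [B0minus] absorbs it, and [ad_r1_tens_UB] keeps track of this through both adjoint actions. *)

Lemma subalg_gen_closed (F : fieldType) (A : algType F) (S : set A) :
  GRing.subalg_closed [in subalg_gen S].
Proof.
split=> [|c u v /set_mem uS /set_mem vS|u v /set_mem uS /set_mem vS];
  apply/mem_set => B BS; have [[B1 Blin BM] _] := BS; apply: set_mem => //.
- by apply: Blin; apply/mem_set; [exact: uS|exact: vS].
- by apply: BM; apply/mem_set; [exact: uS|exact: vS].
Qed.

Lemma subalg_closed_preim (F : fieldType) (A B : algType F)
    (f : {lrmorphism A -> B}) (S : set B) :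
  GRing.subalg_closed [in S] -> GRing.subalg_closed [in (f @^-1` S)%classic].
Proof.
case=> S1 Slin SM; split=> [|c u v /set_mem uS /set_mem vS|u v /set_mem uS /set_mem vS];
  apply/mem_set => /=.
- by rewrite rmorph1; apply: set_mem.
- by rewrite linearP; apply: set_mem; apply: Slin; apply/mem_set.
- by rewrite rmorphM; apply: set_mem; apply: SM; apply/mem_set.
Qed.

Section TensorSub.
Variables (F : fieldType) (q : F) (X Y : set (Uq q)).
Notation T := (tensor_sub X Y).

Lemma tensor_sub_tens x y : X x -> Y y -> T (tens x y).
Proof.
move=> xX yY; exists [:: (x, y)]; rewrite big_seq1; split=> // p.
by rewrite inE => /eqP ->.
Qed.

Lemma tensor_subD t u : T t -> T u -> T (t + u).
Proof.
move=> [s [sXY ->]] [s' [s'XY ->]]; exists (s ++ s'); rewrite big_cat.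
by split=> // p; rewrite mem_cat => /orP[/sXY|/s'XY].
Qed.

Lemma tensor_sub_sum (I : eqType) (r : seq I) (f : I -> tensor (Uq q) (Uq q)) :
  {in r, forall i, T (f i)} -> T (\sum_(i <- r) f i).
Proof.
move=> fT; rewrite big_seq; elim/big_ind: _ => [|t u|i /fT //].
  by exists [::]; rewrite big_nil.
exact: tensor_subD.
Qed.

Lemma tensor_sub_closed :
  GRing.subalg_closed [in X] -> GRing.subalg_closed [in Y] ->
  GRing.subalg_closed [in T].
Proof.
move=> Xalg Yalg; have [X1 Xlin XM] := Xalg; have [Y1 _ YM] := Yalg.
have X0 : 0 \in [in X] by have [] := GRing.subalg_closedZ Xalg.
split=> [|c t u /set_mem tT /set_mem uT|t u /set_mem tT /set_mem uT];
  apply/mem_set.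
- by rewrite -tens1; apply: tensor_sub_tens; apply: set_mem.
- apply: tensor_subD => //; case: tT => s [sXY ->]; rewrite scaler_sumr.
  apply: tensor_sub_sum => p /sXY[pX pY]; rewrite -tensZl.
  apply: tensor_sub_tens => //; apply: set_mem.
  by rewrite -[c *: _]addr0; apply: Xlin => //; apply/mem_set.
- case: tT uT => s [sXY ->] [s' [s'XY ->]]; rewrite mulr_suml.
  apply: tensor_sub_sum => p /sXY[pX pY]; rewrite mulr_sumr.
  apply: tensor_sub_sum => p' /s'XY[p'X p'Y]; rewrite tensM.
  by apply: tensor_sub_tens; apply: set_mem; [apply: XM|apply: YM]; apply/mem_set.
Qed.

End TensorSub.

Section LeftCoideal.
Variables (F : fieldType) (q d : F).
Hypothesis q0 : q != 0.
Notation U := (Uq q).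
Notation K := (uk q).
Notation V := (ukV q).
Notation P := (xip q).
Notation M := (xim q).
Notation D := (Delta q0).
Notation UB := (tensor_sub [set: U] (Bsub q d)).
Notation KK := (tens (K i0) (K i0)).

Let B_closed : GRing.subalg_closed [in Bsub q d].
Proof. exact: subalg_gen_closed. Qed.

Let UB_closed : GRing.subalg_closed [in UB].
Proof.
by apply: tensor_sub_closed => //; split=> [|c x y _ _|x y _ _]; apply/mem_set.
Qed.

Let UBM t u : UB t -> UB u -> UB (t * u).
Proof.
by have [_ _ h] := UB_closed; move=> tU uU; apply: set_mem; apply: h; apply/mem_set.
Qed.

Let UBB t u : UB t -> UB u -> UB (t - u).
Proof.
have [_ h _] := UB_closed; move=> tU uU.
by apply: set_mem; rewrite addrC -scaleN1r; apply: h; apply/mem_set.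
Qed.

Let UBZ c t : UB t -> UB (c *: t).
Proof.
have [z h] := GRing.subalg_closedZ UB_closed.
by move=> tU; apply: set_mem; rewrite -[c *: t]addr0; apply: h => //; apply/mem_set.
Qed.

Let UB1 x : UB (tens x 1).
Proof.
by apply: tensor_sub_tens => //; have [h _ _] := B_closed; apply: set_mem.
Qed.

Lemma Delta_uk i : D (K i) = tens (K i) (K i).
Proof. exact: Uq_liftE. Qed.
Lemma Delta_ukV i : D (V i) = tens (V i) (V i).
Proof. exact: Uq_liftE. Qed.
Lemma Delta_xip i : D (P i) = tens (P i) 1 + tens (K i) (P i).
Proof. exact: Uq_liftE. Qed.
Lemma Delta_xim i : D (M i) = tens (M i) (V i) + tens 1 (M i).
Proof. exact: Uq_liftE. Qed.

Let B_gen x : [set K i1; V i1; P i1; M i1; B0minus q d]%classic x -> Bsub q d x.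
Proof. exact: sub_gen_smallest. Qed.
Let BK : Bsub q d (K i1). Proof. by apply: B_gen; do 4!left. Qed.
Let BV : Bsub q d (V i1). Proof. by apply: B_gen; do 3!left; right. Qed.
Let BP : Bsub q d (P i1). Proof. by apply: B_gen; do 2!left; right. Qed.
Let BM : Bsub q d (M i1). Proof. by apply: B_gen; left; right. Qed.
Let BB : Bsub q d (B0minus q d). Proof. by apply: B_gen; right. Qed.

Let UBK : UB (D (K i1)). Proof. by rewrite Delta_uk; apply: tensor_sub_tens. Qed.
Let UBV : UB (D (V i1)). Proof. by rewrite Delta_ukV; apply: tensor_sub_tens. Qed.
Let UBP : UB (D (P i1)).
Proof. by rewrite Delta_xip; apply: tensor_subD => //; apply: tensor_sub_tens. Qed.
Let UBm : UB (D (M i1)).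
Proof.
by rewrite Delta_xim; apply: tensor_subD; apply: tensor_sub_tens.
Qed.

(** The right adjoint action of xi_i^+ on A (x) A, pulled back along [Delta]. *)
Definition ad_r1_tens (i : 'I_2) (t : tensor U U) : tensor U U :=
  D (V i) * t * D (P i) - D (V i) * D (P i) * t.

Lemma Delta_ad_r1 i x : D (ad_r1 i x) = ad_r1_tens i (D x).
Proof. by rewrite rmorphB !rmorphM. Qed.

(** The summand xi_i^+ (x) 1 of [D (P i)] commutes with 1 (x) x and cancels; in the other summand,
    k_i (x) xi_i^+, the k_i meets k_i^-1 and leaves 1 in the left leg. *)
Lemma Delta_ad_r1_skew i x t : D x = tens (1 : U) x + t ->
  D (ad_r1 i x) = tens (1 : U) (ad_r1 i x) + ad_r1_tens i t.
Proof.
move=> Dx; rewrite Delta_ad_r1 Dx {1}/ad_r1_tens !(mulrDr, mulrDl) opprD addrACA.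
congr (_ + _); rewrite Delta_ukV Delta_xip !(mulrDr, mulrDl) !tensM !mulr1 ukVK.
by rewrite opprD addrACA subrr add0r -tensNr -tensDr.
Qed.

Lemma Delta_xip_ukuk i j : D (P i) * tens (K j) (K j) =
  tens (K j) (K j) * (q ^ (- ahat j i) *: D (P i)).
Proof.
rewrite -scalerAr Delta_xip !(mulrDl, mulrDr) !tensM mulr1 mul1r (uk_comm q j i).
by rewrite !uk_xip tensZl tensZr -scalerDr scalerA mulrC qzK // scale1r.
Qed.

(** k_0 (x) k_0 moves left past [D (P i1)] at the cost of a power of q, so in both terms it lands
    next to t, and the other factors are coproducts already in A (x) B. *)
Lemma ad_r1_tens_UB t : UB (t * KK) -> UB (ad_r1_tens i1 t * KK).
Proof.
move=> tKK; rewrite /ad_r1_tens mulrBl -!mulrA Delta_xip_ukuk; apply: UBB.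
  by rewrite [t * _]mulrA; do !apply: UBM => //; apply: UBZ.
by do !apply: UBM => //.
Qed.

Lemma Delta_B0minus : UB (D (B0minus q d)).
Proof.
pose a := xip' q i0; pose r := ad_r1_tens i1 (ad_r1_tens i1 (tens a (V i0))).
have Da : D a = tens (1 : U) a + tens a (V i0).
  by rewrite rmorphM /= Delta_ukV Delta_xip mulrDr !tensM mulr1 ukVK addrC.
have Dad : D (ad_r [:: i1; i1] a) = tens (1 : U) (ad_r [:: i1; i1] a) + r.
  by do 2!apply: Delta_ad_r1_skew.
have rKK : UB (r * KK).
  by do 2!apply: ad_r1_tens_UB; rewrite tensM ukVK.
have -> : D (B0minus q d) =
    tens (M i0 * K i0) 1 + tens (K i0) (B0minus q d) - d *: (r * KK).
  have -> : B0minus q d = M i0 * K i0 - d *: (ad_r [:: i1; i1] a * K i0).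
    by rewrite scalerAl.
  move: (ad_r _ a) (r) Dad => x t Dx.
  rewrite rmorphB [X in _ - X]linearZ !rmorphM /= Dx Delta_xim Delta_uk.
  rewrite !mulrDl !tensM ukVK !mul1r tensDr tensNr tensZr scalerDr opprD.
  by rewrite !addrA.
by apply: UBB; [apply: tensor_subD => //; apply: tensor_sub_tens|apply: UBZ].
Qed.

Lemma Bsub_left_coideal : left_coideal_subalgebra q0 (Bsub q d).
Proof.
(* Minimality of B among the subalgebras containing its generators. *)
split=> // b; apply: (smallest_sub (subalg_closed_preim _ _ _ D _ UB_closed)) b.
by move=> x [[[[|]|]|]|] ->; last exact: Delta_B0minus.
Qed.

End LeftCoideal.

Theorem proposition2p3 (R : realType) (q : R[i]) (q_neq0 : q != 0)
    (q_transcendental : ~ algebraicOver (ratr : rat -> R[i]) q)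
    (Theta : {additive rootlat -> rootlat})
    (Theta_invol : involutive Theta)
    (Theta_alpha0 : Theta (alpha i0) = - alpha i0 - alpha i1 *+ 2)
    (Theta_alpha1 : Theta (alpha i1) = alpha i1)
    (d_minus : R[i]) (d_neq0 : d_minus != 0) :
  left_coideal_subalgebra q_neq0 (Bsub q d_minus).
Proof. exact: Bsub_left_coideal. Qed.
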